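(* Let $\mathbb{F}=\mathbb{R}$ or $\mathbb{F}=\mathbb{C}$. Let $A,B$ be $m\times s$ matrices and $C,D$ be $n\times s$ matrices over $\mathbb{F}$, and suppose $$\min\left\{\operatorname{rank}\begin{pmatrix}A&B\end{pmatrix},\ \operatorname{rank}\begin{pmatrix}C&D\end{pmatrix}\right\}>\frac{3s}{2}.$$ Then the pencil $$P(\lambda)=\left(AC^{\sf T}+BD^{\sf T}\right)+\lambda\,BC^{\sf T}\in\mathcal{P}_{m,n}(\mathbb{F})$$ has no best approximation in $\mathcal{B}_{s,s}$; that is, the infimum $\inf_{A'+\lambda B'\in\mathcal{B}_{s,s}}\|P(\lambda)-(A'+\lambda B')\|$ is not attained by any element of $\mathcal{B}_{s,s}$.
   Context: $\mathcal{P}_{m,n}(\mathbb{F})$ is the vector space of $m\times n$ pencils $A+\lambda B$ with $A,B\in\mathbb{F}^{m\times n}$, with the norm $\|A+\lambda B\|=\sqrt{\|A\|^2+\|B\|^2}$ (Frobenius norms). $\begin{pmatrix}A&B\end{pmatrix}$ denotes horizontal concatenation and ${}^{\sf T}$ the transpose. The group $\mathrm{GL}_{m,n,2}(\mathbb{F})=\mathrm{GL}_m(\mathbb{F})\times\mathrm{GL}_n(\mathbb{F})\times\mathrm{GL}_2(\mathbb{F})$ acts by $$(P,U,T)\cdot(A+\lambda B)=P(t_{11}A+t_{12}B)U^{\sf T}+\lambda P(t_{21}A+t_{22}B)U^{\sf T},\quad T=(t_{ij}),$$ and $\mathcal{O}(A,B)$ is the orbit of $A+\lambda B$. For integers $r\ge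 s\ge0$, $$\mathcal{B}_{r,s}=\{A+\lambda B\in\mathcal{P}_{m,n}(\mathbb{F}) : \exists\,A'+\lambda B'\in\mathcal{O}(A,B)\text{ with }\operatorname{rank}A'\le r,\ \operatorname{rank}B'\le s\}.$$ *)

(* Defs.v *)
From mathcomp Require Import all_boot all_order all_algebra.
From mathcomp Require Import complex.
From mathcomp Require Import boolp classical_sets reals.

Set Implicit Arguments.
Unset Strict Implicit.
Unset Printing Implicit Defensive.

Import Order.TTheory GRing.Theory Num.Theory.
Local Open Scope classical_set_scope.
Local Open Scope ring_scope.

Variant scalar_kind := RealScalars | ComplexScalars.

Definition scalar_field (R : realType) (k : scalar_kind) : numFieldType :=
  match k with
  | RealScalars => R
  | ComplexScalars => R[i]
  end.

(* The norm of R[i] takes its values in R[i]; its real part is the modulus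
   as an element of R. *)
Definition modulus (R : realType) (k : scalar_kind) : scalar_field R k -> R :=
  match k return scalar_field R k -> R with
  | RealScalars => fun x : R => `|x|
  | ComplexScalars => fun z : R[i] => complex.Re `|z|
  end.

Definition frobenius_norm (R : realType) (k : scalar_kind) (m n : nat)
    (A : 'M[scalar_field R k]_(m, n)) : R :=
  Num.sqrt (\sum_(i < m) \sum_(j < n) modulus (A i j) ^+ 2).

(* The pair (A, B) stands for the pencil A + lambda B. *)
Notation pencil F m n := ('M[F]_(m, n) * 'M[F]_(m, n))%type.

Definition pencil_norm (R : realType) (k : scalar_kind) (m n : nat)
    (X : pencil (scalar_field R k) m n) : R :=
  Num.sqrt (frobenius_norm X.1 ^+ 2 + frobenius_norm X.2 ^+ 2).

Definition pencil_act (F : fieldType) (m n : nat)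
    (P : 'M[F]_m) (U : 'M[F]_n) (T : 'M[F]_2) (X : pencil F m n) :
    pencil F m n :=
  (P *m (T 0 0 *: X.1 + T 0 1 *: X.2) *m U^T,
   P *m (T 1 0 *: X.1 + T 1 1 *: X.2) *m U^T).

Definition pencil_orbit (F : fieldType) (m n : nat) (X : pencil F m n) :
    set (pencil F m n) :=
  [set Y | exists (P : 'M[F]_m) (U : 'M[F]_n) (T : 'M[F]_2),
    [/\ P \in unitmx, U \in unitmx, T \in unitmx & Y = pencil_act P U T X]].

Definition rank_bounded_pencils (F : fieldType) (m n r s : nat) :
    set (pencil F m n) :=
  [set X | exists2 Y, pencil_orbit X Y &
    (\rank Y.1 <= r)%N /\ (\rank Y.2 <= s)%N].

Arguments rank_bounded_pencils : clear implicits.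

(* Main.v *)
(** The pencils [(((B + e A)(C + e D)^T - B C^T) / e) + lambda B C^T] lie in
    [B_{s,s}] and differ from [P] by [e A D^T], so the infimum is [0] and would
    only be attained if [P] itself were in [B_{s,s}]. But a combination of the
    two slices of [P] with a nonzero coefficient [a] on the first one is
    [(A B) M (C D)^T] with [M = [[a I, 0], [b I, a I]]] invertible, so Sylvester's
    rank inequality gives it rank greater than [s]. *)

Require Import Defs.
From mathcomp Require Import all_boot all_order all_algebra.
From mathcomp Require Import complex.
From mathcomp Require Import boolp classical_sets reals.

Set Implicit Arguments.
Unset Strict Implicit.
Unset Printing Implicit Defensive.

Import Order.TTheory GRing.Theory Num.Theory.
Local Open Scope classical_set_scope.
Local Open Scope ring_scope.

Section Pencils.
Variables (R : realType) (k : scalar_kind).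
Local Notation F := (scalar_field R k).

Lemma modulus_ge0 (x : F) : 0 <= modulus x.
Proof.
case: k x => [x|[a b]] /=; first exact: normr_ge0.
by rewrite sqrtr_ge0.
Qed.

Lemma modulus_eq0 (x : F) : modulus x = 0 -> x = 0.
Proof.
case: k x => [x|z]; first exact: normr0_eq0.
(* The real part of the norm of [z] computes to [normc z], so lemmas on [normc] apply by
   conversion. *)
exact: (@ComplexField.Normc.eq0_normc R z).
Qed.

Lemma modulus0 : modulus (0 : F) = 0.
Proof.
case: k; first exact: normr0.
exact: ComplexField.Normc.normc0.
Qed.

Lemma modulusM (x y : F) : modulus (x * y) = modulus x * modulus y.
Proof.
case: k x y => [x y|x y]; first exact: normrM.
exact: ComplexField.Normc.normcM.
Qed.

Lemma modulus_invn (i : nat) : modulus (i.+1%:R^-1 : F) = i.+1%:R^-1.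
Proof.
have i0 : i.+1%:R != 0 :> F by rewrite pnatr_eq0.
have mn : forall j, modulus (j%:R : F) = j%:R.
  move=> j; case: (k); first exact: normr_nat.
  by rewrite -[LHS]/(complex.Re `|j%:R : R[i]|) normr_nat raddfMn.
(* Multiplicativity and the value of [modulus] on naturals determine it on inverses: both sides
   become 1 after multiplication by [i.+1]. *)
apply: (@mulfI _ i.+1%:R); first by rewrite pnatr_eq0.
by rewrite -{1}mn -modulusM !divff ?pnatr_eq0 // (mn 1%N).
Qed.

Lemma frobenius_norm_ge0 m n (M : 'M[F]_(m, n)) : 0 <= frobenius_norm M.
Proof. exact: sqrtr_ge0. Qed.

Lemma frobenius_norm0 m n : frobenius_norm (0 : 'M[F]_(m, n)) = 0.
Proof.
rewrite /frobenius_norm big1 ?sqrtr0 // => i _.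
by rewrite big1 // => j _; rewrite mxE modulus0 expr0n.
Qed.

Lemma frobenius_norm_eq0 m n (M : 'M[F]_(m, n)) :
  frobenius_norm M = 0 -> M = 0.
Proof.
move=> /eqP; rewrite sqrtr_eq0 => M_le0.
have row_ge0 i : 0 <= \sum_(j < n) modulus (M i j) ^+ 2.
  by apply: sumr_ge0 => j _; exact: sqr_ge0.
have /eqP : \sum_(i < m) \sum_(j < n) modulus (M i j) ^+ 2 = 0.
  by apply/eqP; rewrite eq_le M_le0 sumr_ge0.
rewrite psumr_eq0 // => /allP M0.
apply/matrixP => i j; rewrite mxE; apply: modulus_eq0; apply/eqP.
have := M0 i (mem_index_enum i); rewrite psumr_eq0 => [/allP Mi0|l _].
  by have := Mi0 j (mem_index_enum j); rewrite sqrf_eq0.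
exact: sqr_ge0.
Qed.

Lemma frobenius_normZ m n (a : F) (M : 'M[F]_(m, n)) :
  frobenius_norm (a *: M) = modulus a * frobenius_norm M.
Proof.
rewrite -[modulus a]ger0_norm ?modulus_ge0 // -sqrtr_sqr -sqrtrM ?sqr_ge0 //.
congr Num.sqrt; rewrite mulr_sumr; apply: eq_bigr => i _.
by rewrite mulr_sumr; apply: eq_bigr => j _; rewrite mxE modulusM exprMn.
Qed.

Lemma pencil_norm_fst m n (M : 'M[F]_(m, n)) :
  pencil_norm (M, 0) = frobenius_norm M.
Proof.
by rewrite /pencil_norm /= frobenius_norm0 expr0n addr0 sqrtr_sqr
  ger0_norm ?frobenius_norm_ge0.
Qed.

Lemma pencil_norm_eq0 m n (X : pencil F m n) : pencil_norm X = 0 -> X = 0.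
Proof.
case: X => M N /eqP; rewrite sqrtr_eq0 /= => X_le0.
have /eqP : frobenius_norm M ^+ 2 + frobenius_norm N ^+ 2 = 0.
  by apply/eqP; rewrite eq_le X_le0 addr_ge0 ?sqr_ge0.
rewrite paddr_eq0 ?sqr_ge0 // !sqrf_eq0 => /andP[/eqP M0 /eqP N0].
by rewrite (frobenius_norm_eq0 M0) (frobenius_norm_eq0 N0).
Qed.

End Pencils.

Section RankBounds.
Variable F : fieldType.
Variables (m n s : nat).

Lemma mxrank_mul_inner p q (A : 'M[F]_(p, s)) (B : 'M[F]_(s, q)) :
  (\rank (A *m B) <= s)%N.
Proof. exact: leq_trans (mxrankM_maxl _ _) (rank_leq_col _). Qed.

(** The matrix [T] with rows [(e, 1)] and [(0, 1)] clears the difference quotient: it sends the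
    first slice to [(B + e A)(C + e D)^T] and keeps [B C^T]. Both products factor through dimension
    [s]. *)
Lemma secant_rank_bounded (A B : 'M[F]_(m, s)) (C D : 'M[F]_(n, s)) (e : F) :
  e != 0 ->
  rank_bounded_pencils F m n s s
    (A *m C^T + B *m D^T + e *: (A *m D^T), B *m C^T).
Proof.
move=> e0; pose T : 'M[F]_(1 + 1) := block_mx e%:M 1%:M 0 1%:M.
have [T00 T01 T10 T11] : [/\ T 0 0 = e, T 0 1 = 1, T 1 0 = 0 & T 1 1 = 1].
  (* The indices are recast as block indices so that the entries of [block_mx] can be read off. *)
  have -> : (0 : 'I_2) = @lshift 1 1 0 by exact: val_inj.
  have -> : (1 : 'I_2) = @rshift 1 1 0 by exact: val_inj.
  by rewrite block_mxEul block_mxEur block_mxEdl block_mxEdr !mxE.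
eexists.
  exists 1%:M, 1%:M, T; split; [exact: unitmx1|exact: unitmx1| |reflexivity].
  have -> : (T \in unitmx) = (\det T \is a GRing.unit) by exact: unitmxE.
  by rewrite det_ublock det1 mulr1 det_scalar1 unitfE.
rewrite /pencil_act T00 T01 T10 T11 /= trmx1 !mul1mx !mulmx1 scale0r add0r.
rewrite !scale1r mxrank_mul_inner; split=> //.
rewrite [X in \rank X](_ : _ = (B + e *: A) *m (C + e *: D)^T).
  exact: mxrank_mul_inner.
rewrite [(C + _)^T]linearD /= [(e *: D)^T]linearZ /=.
rewrite mulmxDl !mulmxDr -!scalemxAl -!scalemxAr !scalerDr.
by rewrite addrC -[RHS]addrA; congr (_ + _); rewrite addrCA addrA.
Qed.

Lemma mxrank_tangent_comb (A B : 'M[F]_(m, s)) (C D : 'M[F]_(n, s)) (a b : F) :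
  a != 0 ->
  (\rank (row_mx A B) + \rank (row_mx C D) - (s + s)
     <= \rank (a *: (A *m C^T + B *m D^T) + b *: (B *m C^T))%R)%N.
Proof.
move=> a0; pose M : 'M[F]_(s + s) := block_mx a%:M 0 b%:M a%:M.
have Mu : M \in unitmx.
  by rewrite unitmxE det_lblock !det_scalar unitrM !unitrX ?unitfE.
have -> : a *: (A *m C^T + B *m D^T) + b *: (B *m C^T)
    = row_mx A B *m (M *m (row_mx C D)^T).
  rewrite tr_row_mx mul_block_col mul_row_col !mul_scalar_mx mul0mx addr0.
  by rewrite mulmxDr -!scalemxAr scalerDr addrAC addrA.
(* Sylvester's inequality with inner dimension [s + s]; the invertible [M] is then absorbed into the
   right factor without changing its rank. *)
apply: leq_trans (mxrank_mul_min _ _).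
by rewrite -[\rank (row_mx C D)]mxrank_tr (eqmxMfull _ _) // row_full_unit.
Qed.

(** If both transformed slices had rank at most [s], the first column of [T] would vanish, making
    [T] singular. *)
Lemma tangent_not_rank_bounded (A B : 'M[F]_(m, s)) (C D : 'M[F]_(n, s)) :
  (3 * s < \rank (row_mx A B) + \rank (row_mx C D))%N ->
  ~ rank_bounded_pencils F m n s s (A *m C^T + B *m D^T, B *m C^T).
Proof.
move=> hr [_ [P [U [T [Pu Uu Tu ->]]]]] [r0 r1].
have row0 i : (\rank (P *m (T i 0 *: (A *m C^T + B *m D^T)
    + T i 1 *: (B *m C^T)) *m U^T)%R <= s)%N -> T i 0 = 0.
  rewrite mxrankMfree ?row_free_unit ?unitmx_tr //.
  rewrite (eqmxMfull _ _) ?row_full_unit // => r_le.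
  apply/eqP; apply: contraTT hr => Ti0.
  have := leq_trans (mxrank_tangent_comb A B C D (T i 1) Ti0) r_le.
  by rewrite -leqNgt leq_subLR !mulSnr mul0n add0n.
have T0 i : T i 0 = 0.
  case: i => [[|[|//]] i_lt].
    by rewrite -[RHS](row0 0 r0); congr (T _ 0); exact: val_inj.
  by rewrite -[RHS](row0 1 r1); congr (T _ 0); exact: val_inj.
move: Tu; rewrite unitmxE (expand_det_col _ 0) big1 ?unitr0 // => i _.
by rewrite T0 mul0r.
Qed.

End RankBounds.

Theorem proposition17 (R : realType) (k : scalar_kind) (m n s : nat)
    (A B : 'M[scalar_field R k]_(m, s)) (C D : 'M[scalar_field R k]_(n, s))
    (hrank : (3 * s)%:R / 2
      < (minn (\rank (row_mx A B)) (\rank (row_mx C D)))%:R :> rat) :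
  let P : pencil (scalar_field R k) m n :=
    (A *m C^T + B *m D^T, B *m C^T) in
  let Bss := rank_bounded_pencils (scalar_field R k) m n s s in
  ~ exists2 X, Bss X &
      pencil_norm (P - X) = inf [set pencil_norm (P - Y) | Y in Bss].
Proof.
move=> P Bss [X BX PX].
(* The sum of the two ranks is at least twice their minimum. *)
have hr : (3 * s < \rank (row_mx A B) + \rank (row_mx C D))%N.
  move: hrank; rewrite ltr_pdivrMr // -natrM ltr_nat => /leq_trans; apply.
  by rewrite muln2 -addnn leq_add ?geq_minl ?geq_minr.
suff PX0 : pencil_norm (P - X) = 0.
  apply: (tangent_not_rank_bounded hr).
  by move/pencil_norm_eq0/eqP: PX0; rewrite subr_eq0 => /eqP PX'; rewrite -/P PX'.
set c := frobenius_norm (A *m D^T).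
have PXle i : pencil_norm (P - X) <= i.+1%:R^-1 * c.
  (* The secant pencil is taken at a negative [e], so that its difference from [P] is exactly
     [i.+1%:R^-1 *: (A *m D^T)] in the first slice and 0 in the second. *)
  have e0 : (- i.+1%:R^-1 : scalar_field R k) != 0.
    by rewrite oppr_eq0 invr_eq0 pnatr_eq0.
  rewrite PX -(modulus_invn R k) -frobenius_normZ -pencil_norm_fst.
  (* An infimum lies below each element only when the set has a lower bound, here 0. *)
  apply: ge_inf; first by exists 0 => _ [Y _ <-]; exact: sqrtr_ge0.
  eexists; first exact: (secant_rank_bounded A B C D e0).
  by congr pencil_norm; congr pair; rewrite /= ?subrr // scaleNr opprB addrC subrK.
apply/eqP; rewrite eq_le sqrtr_ge0 andbT leNgt; apply/negP => PX_gt0.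
set d := pencil_norm (P - X) in PXle PX_gt0.
(* Archimedean choice: an index above [c / d] makes [c / i.+1] smaller than [d], against [PXle]. *)
have := PXle (Num.bound (c / d)); rewrite mulrC ler_pdivlMr // leNgt => /negP[].
rewrite mulrC -ltr_pdivrMr //.
apply: lt_le_trans (archi_boundP _) _; last by rewrite ler_nat.
by rewrite divr_ge0 ?frobenius_norm_ge0 // ltW.
Qed.
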